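(* Consider any $0\le\gamma\le0.25$. For any integers $0\le k_0\le\sqrt n$ and $\max(\sqrt n,48)\le\Delta\le n-k_0$, $$\rho^{*2}_{\gamma,\mathrm{var}}[k_0,\Delta]\ \ge\ c\,\sigma_+^2\sqrt{\Delta n^{1/2}},$$ where $c>0$ is a numerical constant.
   Context: Model: $Y_i=\theta_i+\epsilon_i$, $i=1,\dots,n$, with $\theta\in\mathbb R^n$ unknown and $\epsilon_i$ i.i.d. $\mathcal N(0,\sigma^2)$, where $\sigma$ is unknown but belongs to a fixed interval $[\sigma_-,\sigma_+]$ with $0<\sigma_-<\sigma_+$ known; $\mathbb P_{\theta,\sigma}$ is the law of $Y$. $\mathbb B_0[k]=\{\theta\in\mathbb R^n:\|\theta\|_0\le k\}$, where $\|\theta\|_0$ is the number of non-zero entries; $d_2$ is the Euclidean distance; $\mathbb B_0[k_1,k_0,\rho]=\{\theta\in\mathbb B_0[k_1]:d_2(\theta,\mathbb B_0[k_0])\ge\rho\}$. For a test $T$ (measurable $\{0,1\}$-valued function of $Y$, not depending on $\sigma$), $$R_{\mathrm{var}}(T;k_0,\Delta,\rho)=\sup_{\theta\in\mathbb B_0[k_0],\,\sigma\in[\sigma_-,\sigma_+]}\mathbb P_{\theta,\sigma}[T=1]+\sup_{\theta\in\mathbb B_0[k_0+\Delta,k_0,\rho],\,\sigma\in[\sigma_-,\sigma_+]}\mathbb P_{\theta,\sigma}[T=0],$$ $\rho_{\gamma,\mathrm{var}}(T;k_0,\Delta)=\sup\{\rho>0:R_{\mathrm{var}}(T;k_0,\Delta,\rho)>\gamma\}$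 and $\rho^*_{\gamma,\mathrm{var}}[k_0,\Delta]=\inf_T\rho_{\gamma,\mathrm{var}}(T;k_0,\Delta)$, infimum over all tests; $\rho^{*2}_{\gamma,\mathrm{var}}$ denotes its square.
   Formalization: The constant c is allowed to depend on an upper bound q < 1 for the ratio σ₋/σ₊ (and on nothing else), because a constant uniform over all intervals [σ₋,σ₊] is impossible: for σ₋ close to σ₊ the chi-square test does better. *)

(* Defs.v *)
From HB Require Import structures.
From mathcomp Require Import all_boot all_order all_algebra.
From mathcomp Require Import all_classical all_reals all_analysis.

Set Implicit Arguments.
Unset Strict Implicit.
Unset Printing Implicit Defensive.
Import Order.TTheory GRing.Theory Num.Theory.

Local Open Scope classical_set_scope.
Local Open Scope ring_scope.

Section product_probability.
Context d1 d2 (T1 : measurableType d1) (T2 : measurableType d2) (R : realType).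
Variables (P : probability T1 R) (Q : probability T2 R).

Definition prodP : set (T1 * T2) -> \bar R := (P \x Q)%E.

HB.instance Definition _ := Measure.copy prodP (P \x Q)%E.

Let prodP_setT : prodP setT = 1%E.
Proof.
rewrite /prodP -setXTT product_measure1E//.
by rewrite [X in (X * _)%E](probability_setT P) [X in (_ * X)%E](probability_setT Q) mule1.
Qed.

HB.instance Definition _ := Measure_isProbability.Build _ _ _ prodP prodP_setT.

End product_probability.

Section tuple_product.
Context d (T : measurableType d) (R : realType).

Definition tcons n (x : T * n.-tuple T) : n.+1.-tuple T := [tuple of x.1 :: x.2].

Let measurable_tcons n : measurable_fun setT (@tcons n).
Proof. by apply: measurable_cons. Qed.

HB.instance Definition _ n := isMeasurableFun.Build _ _ _ _ (@tcons n)
  (measurable_tcons (n := n)).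

(* The product probability mu_0 x ... x mu_(n-1) on the product sigma-algebra
   of n.-tuple T; tuple_prodPE gives its characteristic values on rectangles. *)
Fixpoint tuple_prodP n : ('I_n -> probability T R) -> probability (n.-tuple T) R :=
  match n with
  | 0 => fun=> \d_[tuple]
  | m.+1 => fun mu =>
      distribution (prodP (mu ord0) (tuple_prodP (fun i => mu (lift ord0 i))))
        (@tcons m)
  end.

Lemma tuple_prodPE n (mu : 'I_n -> probability T R) (A : 'I_n -> set T) :
  (forall i, measurable (A i)) ->
  tuple_prodP mu [set y | forall i, A i (tnth y i)] =
  (\prod_(i < n) mu i (A i))%E.
Proof.
elim: n mu A => [|n ih] mu A mA.
  by rewrite big_ord0 /= diracE mem_set// => -[].
rewrite big_ord_recl -ih// /distribution /pushforward /=.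
set B := [set y : n.-tuple T | forall i, A (lift ord0 i) (tnth y i)].
have mB : measurable B.
  rewrite (_ : B = \big[setI/setT]_(i < n) ((@tnth _ T ^~ i) @^-1` A (lift ord0 i))).
    apply: bigsetI_measurable => i _; rewrite -[X in measurable X]setTI.
    by apply: measurable_tnth.
  apply/seteqP; split=> y; rewrite -bigcap_seq /=.
    by move=> By i _; exact: By.
  by move=> By i; apply: By => /=; exact: mem_index_enum.
rewrite (_ : _ @^-1` _ = A ord0 `*` B).
  by rewrite /prodP product_measure1E.
apply/seteqP; split=> [[x y] /= H|[x y] /= [Ax By] i].
  by split; [have := H ord0|move=> i; have := H (lift ord0 i); rewrite tnthS].
by case: (unliftP ord0 i) => [j ->|->]; rewrite ?tnthS//; exact: By.
Qed.
End tuple_product.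

Section sparsity_testing.
Context {R : realType} {n : nat}.
Implicit Types (theta : 'rV[R]_n) (T : {mfun n.-tuple (measurableTypeR R) >-> bool}).

(* sigma is the standard deviation, as in normal_prob. *)
Definition gauss_law theta (sigma : R) :
    probability (n.-tuple (measurableTypeR R)) R :=
  tuple_prodP (fun i : 'I_n => normal_prob (theta ord0 i) sigma).

Definition l0norm theta : nat := #|[set i : 'I_n | theta ord0 i != 0]%SET|.

Definition sparse_ball (k : nat) : set 'rV[R]_n :=
  [set theta | (l0norm theta <= k)%N].

(* The norm of 'rV[R]_n in the library is the sup norm, hence this one. *)
Definition d2 theta theta' : R :=
  Num.sqrt (\sum_(i < n) (theta ord0 i - theta' ord0 i) ^+ 2).

Definition d2_set theta (S : set 'rV[R]_n) : R := inf [set d2 theta u | u in S].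

Definition sparse_ball_away (k1 k0 : nat) (rho : R) : set 'rV[R]_n :=
  [set theta | sparse_ball k1 theta /\ rho <= d2_set theta (sparse_ball k0)].

(* Supremum in [0, +oo], with value 0 (instead of -oo) on the empty set. *)
Definition sup_ge0 (S : set (\bar R)) : \bar R := ereal_sup (0%E |` S).

Section risk.
Variables sigma_m sigma_p : R.

Definition R_var T (k0 Delta : nat) (rho : R) : \bar R :=
  (sup_ge0 [set gauss_law theta sigma [set y | T y = true]
           | theta in sparse_ball k0 & sigma in `[sigma_m, sigma_p]] +
   sup_ge0 [set gauss_law theta sigma [set y | T y = false]
           | theta in sparse_ball_away (k0 + Delta)%N k0 rho
           & sigma in `[sigma_m, sigma_p]])%E.

Definition rho_var (gamma : R) T (k0 Delta : nat) : \bar R :=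
  sup_ge0 [set rho%:E | rho in
    [set rho : R | 0 < rho /\ (gamma%:E < R_var T k0 Delta rho)%E]].

Definition rho_star_var (gamma : R) (k0 Delta : nat) : \bar R :=
  ereal_inf [set rho_var gamma T k0 Delta | T in setT].

End risk.

End sparsity_testing.

Arguments rho_star_var {R} n sigma_m sigma_p gamma k0 Delta.

(* Main.v *)
Require Import Defs.
From HB Require Import structures.
From mathcomp Require Import all_boot all_order all_algebra.
From mathcomp Require Import all_classical all_reals all_analysis.
From mathcomp Require Import measurable_realfun ring lra.
Import Order.TTheory GRing.Theory Num.Theory.
Local Open Scope classical_set_scope.
Local Open Scope ring_scope.
Set Implicit Arguments.
Unset Strict Implicit.
Unset Printing Implicit Defensive.

(* Bayesian lower bound. Under the null theta = 0 and the noise level is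
   sigma_p; under the alternative the theta_i are i.i.d., equal to 0 with
   probability 1 - p and to +a, -a with probability p / 2 each, and the noise
   variance sigma_p^2 - p a^2 is chosen so that each Y_i has the same variance
   under both (its odd moments agree by symmetry). With b = a^2 / sigma_p^2, the
   first discrepancy is of fourth order, and the likelihood ratio L of the
   mixture satisfies E L^2 <= (1 + 7 p^2 b^4)^n. For n p = k0 + Delta / 2 this is
   close to 1 as soon as b is a small multiple of (sqrt n / Delta)^(1/2), small
   enough for the alternative noise level to stay above q sigma_p. By
   Chebyshev's inequality, the number of nonzero theta_i lies within Delta / 4 of
   k0 + Delta / 2 with probability at least 1/2, and then the squared distance to
   B_0[k0] is at least a^2 Delta / 4, of order sigma_p^2 (Delta sqrt n)^(1/2). *)

(** * Integration against a measure given by a density *)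

Section density.
Context d (T : measurableType d) (R : realType).
Variables (mu nu : {measure set T -> \bar R}) (f : T -> R).
Hypotheses (mf : measurable_fun setT f) (f0 : forall x, 0 <= f x).
Hypothesis nuE : forall A, measurable A -> nu A = (\int[mu]_(x in A) (f x)%:E)%E.
Import HBNNSimple.

Let density_nnsfun (g : {nnsfun T >-> R}) :
  (\int[nu]_x (g x)%:E = \int[mu]_x ((g x)%:E * (f x)%:E))%E.
Proof.
transitivity (\sum_(r \in range g) (r%:E * nu (g @^-1` [set r]))%E)%E.
  by rewrite integralT_nnsfun sintegralE.
under [RHS]eq_integral => x _.
  rewrite (fimfunE g x) -fsumEFin// ge0_mule_fsuml; last first.
    by move=> r; rewrite EFinM nnfun_muleindic_ge0.
  over.
rewrite ge0_integral_fsum//; last 2 first.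
- move=> r; apply: emeasurable_funM; last exact/measurable_EFinP.
  by apply/measurable_EFinP/measurable_funM.
- by move=> r x _; rewrite mule_ge0 ?lee_fin// -lee_fin EFinM nnfun_muleindic_ge0.
apply: eq_fsbigr => r _.
(* A negative level [r] has empty preimage, so both sides vanish; for [r >= 0] the factor can be
   taken out of the integral. *)
have [r0|r0] := leP 0 r; last first.
  by rewrite preimage_nnfun0// measure0 mule0 integral0_eq// => x _; rewrite indic0 mulr0 mul0e.
under eq_integral => x _ do rewrite EFinM -muleA.
rewrite ge0_integralZl//; last 2 first.
- apply: emeasurable_funM; apply/measurable_EFinP => //.
- by move=> x _; rewrite mule_ge0 ?lee_fin.
congr (_ * _)%E; rewrite nuE// [LHS]integral_mkcond.
apply: eq_integral => x _; rewrite patchE indicE.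
by case: (_ \in _); rewrite ?mul1e ?mul0e.
Qed.

(** The identity [nuE] on sets passes to simple functions by linearity, and to [h] by monotone
    convergence along increasing simple approximations. *)
Lemma ge0_integral_density (h : T -> \bar R) :
  measurable_fun setT h -> (forall x, 0 <= h x)%E ->
  (\int[nu]_x h x = \int[mu]_x (h x * (f x)%:E))%E.
Proof.
move=> mh h0; pose g := nnsfun_approx measurableT mh.
have gh x : (g n x)%:E @[n --> \oo] --> h x by exact: cvg_nnsfun_approx.
have ndg x m n : (m <= n)%N -> ((g m x)%:E <= (g n x)%:E)%E.
  by move=> mn; rewrite lee_fin; exact/lefP/nd_nnsfun_approx.
transitivity (limn (fun n => \int[nu]_x (g n x)%:E))%E.
  rewrite -monotone_convergence//.
  - by apply: eq_integral => x _; apply/esym/cvg_lim.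
  - by move=> n; exact/measurable_EFinP.
  - by move=> n x _; rewrite lee_fin.
  - by move=> x _ m n; exact: ndg.
transitivity (limn (fun n => \int[mu]_x ((g n x)%:E * (f x)%:E)))%E.
  by congr (limn _); apply/funext => n; exact: density_nnsfun.
rewrite -monotone_convergence//.
- apply: eq_integral => x _; apply/cvg_lim => //.
  by apply: cvgeZr.
- by move=> n; apply: emeasurable_funM; exact/measurable_EFinP.
- by move=> n x _; rewrite mule_ge0 ?lee_fin.
- by move=> x _ m n mn; rewrite lee_wpmul2r ?lee_fin// -lee_fin; exact: ndg.
Qed.

End density.

(** * Integrals and densities of product laws on tuples *)

Section tuple_product_integral.
Context d (T : measurableType d) (R : realType).
Local Open Scope ereal_scope.

Lemma ge0_integral_tuple_prodP0 (mu : 'I_0 -> probability T R)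
    (h : 0.-tuple T -> \bar R) :
  measurable_fun setT h -> \int[tuple_prodP mu]_y h y = h [tuple].
Proof. by move=> mh; rewrite /= integral_dirac// diracT mul1e. Qed.

Lemma ge0_integral_tuple_prodPS n (mu : 'I_n.+1 -> probability T R)
    (h : n.+1.-tuple T -> \bar R) :
  measurable_fun setT h -> (forall y, 0 <= h y) ->
  \int[tuple_prodP mu]_y h y =
  \int[mu ord0]_x \int[tuple_prodP (fun i => mu (lift ord0 i))]_y
     h (tcons (x, y)).
Proof.
move=> mh h0; rewrite /= ge0_integral_distribution//.
have mth : measurable_fun setT (h \o @tcons _ T n).
  by apply: measurableT_comp => //; exact: measurable_funP.
rewrite (@fubini_tonelli1 _ _ _ _ _ (mu ord0) (tuple_prodP (fun i => mu (lift ord0 i))) (h \o @tcons _ T n))//.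
by move=> z; exact: h0.
Qed.

End tuple_product_integral.

Section tuple_product_density.
Context d (T : measurableType d) (R : realType).

Lemma measurable_prod_tnth n (f : 'I_n -> T -> R) :
  (forall i, measurable_fun setT (f i)) ->
  measurable_fun setT (fun y : n.-tuple T => \prod_i f i (tnth y i)).
Proof.
move=> mf; apply: measurable_prod => i _.
by apply: measurableT_comp => //; exact: measurable_tnth.
Qed.

Lemma prod_tnth_tcons n (f : 'I_n.+1 -> T -> R) x (y : n.-tuple T) :
  \prod_i f i (tnth (tcons (x, y)) i) =
  f ord0 x * \prod_i f (lift ord0 i) (tnth y i).
Proof.
by rewrite big_ord_recl; congr (_ * _); apply: eq_bigr => i _; rewrite tnthS.
Qed.

Local Open Scope ereal_scope.

Lemma measurable_tcons n : measurable_fun setT (@tcons _ T n).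
Proof. exact: measurable_funP. Qed.

(** Induction on [n], splitting off the first coordinate by Tonelli. The density hypothesis is
    stated for integrals rather than sets so that it applies directly to the inner integral, seen as
    a function of the first coordinate. *)
Lemma ge0_integral_tuple_prodP_density n (mu nu : 'I_n -> probability T R)
    (f : 'I_n -> T -> R) (h : n.-tuple T -> \bar R) :
  (forall i, measurable_fun setT (f i)) -> (forall i x, 0 <= f i x)%R ->
  (forall i g, measurable_fun setT g -> (forall x, 0 <= g x) ->
    \int[nu i]_x g x = \int[mu i]_x (g x * (f i x)%:E)) ->
  measurable_fun setT h -> (forall y, 0 <= h y) ->
  \int[tuple_prodP nu]_y h y =
  \int[tuple_prodP mu]_y (h y * (\prod_i f i (tnth y i))%:E).
Proof.
elim: n mu nu f h => [|n ih] mu nu f h mf f0 nuE mh h0.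
  have mh1 : measurable_fun setT
      (fun y => h y * (\prod_i f i (tnth y i))%:E).
    by apply: emeasurable_funM => //; apply/measurable_EFinP; exact: measurable_prod_tnth.
  by rewrite !ge0_integral_tuple_prodP0// big_ord0 mule1.
have mh1 : measurable_fun setT (fun y => h y * (\prod_i f i (tnth y i))%:E).
  by apply: emeasurable_funM => //; apply/measurable_EFinP; exact: measurable_prod_tnth.
have mF : measurable_fun setT (fun y : n.-tuple T =>
    (\prod_i f (lift ord0 i) (tnth y i))%:E).
  apply/measurable_EFinP; exact: (@measurable_prod_tnth n (fun i => f (lift ord0 i))).
have F0 y : 0 <= (\prod_i f (lift ord0 i) (tnth y i))%:E.
  by rewrite lee_fin prodr_ge0.
have mhc x : measurable_fun setT (fun y => h (tcons (x, y))).
  apply: (measurableT_comp mh).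
  by apply: (measurableT_comp (@measurable_tcons n)); exact: measurable_pair1.
rewrite !ge0_integral_tuple_prodPS//; last first.
  by move=> y; rewrite mule_ge0// lee_fin; apply: prodr_ge0.
have E x : \int[tuple_prodP (fun i => nu (lift ord0 i))]_y h (tcons (x, y)) =
    \int[tuple_prodP (fun i => mu (lift ord0 i))]_y
      (h (tcons (x, y)) * (\prod_i f (lift ord0 i) (tnth y i))%:E).
  by apply: (ih _ _ (fun i => f (lift ord0 i))) => // i g; exact: nuE.
under eq_integral do rewrite E.
rewrite nuE//; last 2 first.
- pose G (z : T * n.-tuple T) := h (tcons z) *
    (\prod_i f (lift ord0 i) (tnth z.2 i))%:E.
  apply: (@measurable_fun_fubini_tonelli_F _ _ _ _ _ (tuple_prodP (fun i => mu (lift ord0 i))) G).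
    apply: emeasurable_funM.
      by apply: (measurableT_comp mh); exact: measurable_tcons.
    exact: (measurableT_comp mF).
  by move=> z; rewrite mule_ge0.
- by move=> x; apply: integral_ge0 => y _; rewrite mule_ge0.
apply: eq_integral => x _.
rewrite -ge0_integralZr//; last 3 first.
- by apply: emeasurable_funM.
- by move=> y _; rewrite mule_ge0.
- by rewrite lee_fin.
apply: eq_integral => y _.
by rewrite prod_tnth_tcons EFinM -!muleA; congr (_ * _); rewrite muleC.
Qed.

(** Independence: the factor of the first coordinate is a constant for the inner integral, and
    induction separates the others. *)
Lemma ge0_integral_tuple_prodP_prod n (mu : 'I_n -> probability T R)
    (f : 'I_n -> T -> R) :
  (forall i, measurable_fun setT (f i)) -> (forall i x, 0 <= f i x)%R ->
  \int[tuple_prodP mu]_y (\prod_i f i (tnth y i))%:E =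
  \prod_i \int[mu i]_x (f i x)%:E.
Proof.
elim: n mu f => [|n ih] mu f mf f0.
  rewrite ge0_integral_tuple_prodP0 ?big_ord0//.
  apply/measurable_EFinP; exact: measurable_prod_tnth.
have mF : measurable_fun setT (fun y : n.-tuple T =>
    (\prod_i f (lift ord0 i) (tnth y i))%:E).
  apply/measurable_EFinP; exact: (@measurable_prod_tnth n (fun i => f (lift ord0 i))).
rewrite ge0_integral_tuple_prodPS; last 2 first.
- apply/measurable_EFinP; exact: measurable_prod_tnth.
- by move=> y; rewrite lee_fin prodr_ge0.
under eq_integral => x _.
  under eq_integral => y _ do rewrite prod_tnth_tcons EFinM.
  rewrite ge0_integralZl ?lee_fin//; last by move=> y _; rewrite lee_fin prodr_ge0.
  rewrite (ih _ (fun i => f (lift ord0 i)))//.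
  over.
rewrite big_ord_recl ge0_integralZr//.
- by apply/measurable_EFinP.
- by move=> x _; rewrite lee_fin.
- by apply: prode_ge0 => i _; apply: integral_ge0 => x _; rewrite lee_fin.
Qed.

End tuple_product_density.

(** * Second moment method for two laws *)

Section chi_square.
Context d (T : measurableType d) (R : realType).
Variables (P : probability T R) (L : T -> R).
Hypotheses (mL : measurable_fun setT L) (L0 : forall x, 0 <= L x).
Hypothesis L1 : (\int[P]_x (L x)%:E = 1)%E.

(* Le Cam's bound: the integrand inequality is [(L - 1 + t)^2 >= 0] on [A] and
   [(L - 1)^2 + t^2 >= 0] off [A], divided by [2 t]. *)
Lemma le_probability_chi_square (t : R) (A : set T) : 0 < t -> measurable A ->
  (\int[P]_x (L x ^+ 2)%:E <= (1 + t ^+ 2)%:E)%E ->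
  (P A <= \int[P]_(x in A) (L x)%:E + t%:E)%E.
Proof.
move=> t0 mA L2.
have mLA : measurable_fun setT (fun x => (\1_A x * L x)%:E).
  by apply/measurable_EFinP; apply: measurable_funM.
have m2 : measurable_fun setT (fun x => (L x ^+ 2)%:E).
  by apply/measurable_EFinP; apply: measurable_funX.
(* The term in [L x / t] from the expanded squares stands on the left, so that both integrands are
   nonnegative and no subtraction in the extended reals occurs. *)
have ineq : (\int[P]_x ((\1_A x)%:E + t^-1%:E * (L x)%:E) <=
    \int[P]_x ((\1_A x * L x)%:E + ((t / 2 + (2 * t)^-1)%:E + (2 * t)^-1%:E * (L x ^+ 2)%:E)))%E.
  apply: ge0_le_integral => //.
  - by move=> x _; rewrite -EFinM -EFinD lee_fin addr_ge0// mulr_ge0// invr_ge0 ltW.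
  - by apply: emeasurable_funD; [|apply: emeasurable_funM => //]; exact/measurable_EFinP.
  - apply: emeasurable_funD => //; apply: emeasurable_funD => //.
    by apply: emeasurable_funM.
  - move=> x _; rewrite -!EFinM -!EFinD lee_fin -subr_ge0.
    rewrite indicE; case: (_ \in _); rewrite /= ?mulr1n ?mulr0n ?mul1r ?mul0r.
      rewrite (_ : _ - _ = (L x - 1 + t) ^+ 2 / (2 * t)); last by field; rewrite gt_eqF.
      by rewrite divr_ge0 ?sqr_ge0// mulr_ge0// ltW.
    rewrite (_ : _ - _ = ((L x - 1) ^+ 2 + t ^+ 2) / (2 * t)); last by field; rewrite gt_eqF.
    by rewrite divr_ge0 ?addr_ge0 ?sqr_ge0// mulr_ge0// ltW.
have i0 : (0 <= t / 2 + (2 * t)^-1) by rewrite addr_ge0// ?invr_ge0 ?mulr_ge0// ltW.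
have i1 : (0 <= (2 * t)^-1) by rewrite invr_ge0 ?mulr_ge0// ltW.
have LAE : (\int[P]_(x in A) (L x)%:E = \int[P]_x (\1_A x * L x)%:E)%E.
  rewrite [LHS]integral_mkcond; apply: eq_integral => x _; rewrite patchE indicE.
  by case: (_ \in _); rewrite ?mul1r ?mul0r.
have m1 : measurable_fun setT (fun x => (L x)%:E) by apply/measurable_EFinP.
have mI : measurable_fun setT (fun x => (\1_A x : R)%:E) by apply/measurable_EFinP.
have ge1 x : setT x -> (0 <= t^-1%:E * (L x)%:E)%E.
  by move=> _; rewrite -EFinM lee_fin mulr_ge0// invr_ge0 ltW.
have meas1 : measurable_fun setT (fun x => t^-1%:E * (L x)%:E)%E.
  exact: emeasurable_funM.
have ge2 x : setT x -> (0 <= (2 * t)^-1%:E * (L x ^+ 2)%:E)%E.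
  by move=> _; rewrite -EFinM lee_fin mulr_ge0// sqr_ge0.
have meas2 : measurable_fun setT (fun x => (2 * t)^-1%:E * (L x ^+ 2)%:E)%E.
  exact: emeasurable_funM.
have ge3 x : setT x -> (0 <= (t / 2 + (2 * t)^-1)%:E + (2 * t)^-1%:E * (L x ^+ 2)%:E)%E.
  by move=> Tx; rewrite adde_ge0// ge2.
have meas3 : measurable_fun setT (fun x =>
    (t / 2 + (2 * t)^-1)%:E + (2 * t)^-1%:E * (L x ^+ 2)%:E)%E.
  exact: emeasurable_funD.
have ge4 x : setT x -> (0 <= (\1_A x * L x)%:E)%E.
  by move=> _; rewrite lee_fin mulr_ge0.
rewrite LAE.
move: ineq.
rewrite ge0_integralD// integral_indic// setIT ge0_integralZl ?lee_fin ?invr_ge0 ?(ltW t0)//; last first.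
  by move=> x _; rewrite lee_fin.
rewrite L1 mule1 ge0_integralD// ge0_integralD// integral_cst//.
rewrite [X in (_ * X)%E](probability_setT P) mule1 ge0_integralZl//; last first.
  by move=> x _; rewrite lee_fin sqr_ge0.
move=> ineq.
set q := (\int[P]_x (\1_A x * L x)%:E)%E in ineq *.
set r := (\int[P]_x (L x ^+ 2)%:E)%E in L2 ineq.
have q0 : (0 <= q)%E by apply: integral_ge0 => x _; rewrite lee_fin mulr_ge0.
(* The mean 1 of [L] and the bound on its second moment turn the constants into [t^-1] on the left
   and [t + t^-1] on the right; [t^-1] cancels. *)
have {ineq} : (P A + t^-1%:E <= q + ((t / 2 + (2 * t)^-1)%:E + (2 * t)^-1%:E * (1 + t ^+ 2)%:E))%E.
  by apply: (le_trans ineq); rewrite leeD2l// leeD2l// lee_wpmul2l.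
rewrite -EFinM -EFinD.
rewrite (_ : t / 2 + (2 * t)^-1 + (2 * t)^-1 * (1 + t ^+ 2) = t + t^-1); last by field; rewrite gt_eqF.
by rewrite EFinD addeA leeD2rE.
Qed.

End chi_square.

(** * Likelihood ratios of normal laws against a centred one *)

Section normal_likelihood_ratio.
Context {R : realType}.
Implicit Types (u v sigma tau delta : R).

Lemma normal_pdf_expE v sigma x : 0 < sigma ->
  normal_pdf v sigma x = (sigma * Num.sqrt (2 * pi))^-1 *
    expR (- (x - v) ^+ 2 / (sigma ^+ 2 *+ 2)).
Proof.
move=> s0; rewrite normal_pdfE ?gt_eqF//; congr (_^-1 * _).
rewrite -mulr_natr -mulrA (mulrC pi) sqrtrM ?sqr_ge0//.
by rewrite sqrtr_sqr gtr0_norm.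
Qed.

Lemma sqrt_2pi_gt0 : 0 < Num.sqrt (2 * pi) :> R.
Proof. by rewrite sqrtr_gt0 mulr_gt0// pi_gt0. Qed.

Lemma normal_pdf_gt0 v sigma x : 0 < sigma -> 0 < normal_pdf v sigma x.
Proof.
move=> s0; rewrite normal_pdf_expE//.
by rewrite mulr_gt0 ?expR_gt0// invr_gt0 mulr_gt0// sqrt_2pi_gt0.
Qed.

Definition normal_ratio v sigma tau x := normal_pdf v sigma x / normal_pdf 0 tau x.

Lemma normal_ratio_ge0 v sigma tau x : 0 <= normal_ratio v sigma tau x.
Proof. by rewrite divr_ge0// normal_pdf_ge0. Qed.

Lemma measurable_normal_ratio v sigma tau : 0 < tau ->
  measurable_fun setT (normal_ratio v sigma tau).
Proof.
move=> t0; apply: measurable_funM; first exact: measurable_normal_pdf.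
rewrite (_ : (fun x => _) = (fun x => (tau * Num.sqrt (2 * pi)) *
  expR ((x - 0) ^+ 2 / (tau ^+ 2 *+ 2)))); last first.
  apply/funext => x; rewrite normal_pdf_expE// invfM invrK; congr (_ * _).
  by rewrite -expRN mulNr opprK.
apply: measurable_funM => //; apply: measurableT_comp => //.
apply: measurable_funM => //; apply: measurable_funX => //.
exact: measurable_funB.
Qed.

Lemma ge0_integral_normal_prob v sigma (g : R -> \bar R) :
  measurable_fun setT g -> (forall x, 0 <= g x)%E ->
  (\int[normal_prob v sigma]_x g x =
   \int[lebesgue_measure]_x (g x * (normal_pdf v sigma x)%:E))%E.
Proof.
move=> mg g0; apply: ge0_integral_density => //.
- exact: measurable_normal_pdf.
- exact: normal_pdf_ge0.
Qed.

Lemma ge0_integral_normal_ratio v sigma tau (g : R -> \bar R) : 0 < tau ->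
  measurable_fun setT g -> (forall x, 0 <= g x)%E ->
  (\int[normal_prob v sigma]_x g x =
   \int[normal_prob 0 tau]_x (g x * (normal_ratio v sigma tau x)%:E))%E.
Proof.
move=> t0 mg g0; rewrite !ge0_integral_normal_prob//.
- apply: eq_integral => x _; rewrite -muleA -EFinM /normal_ratio divfK//.
  by rewrite gt_eqF// normal_pdf_gt0.
- by apply: emeasurable_funM => //; apply/measurable_EFinP; exact: measurable_normal_ratio.
- by move=> x; rewrite mule_ge0// lee_fin normal_ratio_ge0.
Qed.

Lemma normal_ratioM_null_pdf u v sigma tau x : 0 < tau ->
  normal_ratio u sigma tau x * normal_ratio v sigma tau x * normal_pdf 0 tau x =
  normal_pdf u sigma x * normal_pdf v sigma x / normal_pdf 0 tau x.
Proof.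
by move=> t0; rewrite /normal_ratio; field; rewrite gt_eqF ?normal_pdf_gt0.
Qed.

(* Completing the square: the product of the two densities over the null
   density is a multiple of the density of the normal law with mean
   (u + v) / (1 + delta) and variance tau^2 (1 - delta) / (1 + delta). *)
Lemma normal_ratioM_pdf u v sigma tau delta x : 0 < sigma -> 0 < tau ->
  0 <= delta < 1 -> sigma ^+ 2 = tau ^+ 2 * (1 - delta) ->
  normal_ratio u sigma tau x * normal_ratio v sigma tau x * normal_pdf 0 tau x =
  (Num.sqrt (1 - delta ^+ 2))^-1 *
    expR ((u * v - delta * (u ^+ 2 + v ^+ 2) / 2) /
          (tau ^+ 2 * (1 - delta ^+ 2))) *
  normal_pdf ((u + v) / (1 + delta))
    (tau * (1 - delta) / Num.sqrt (1 - delta ^+ 2)) x.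
Proof.
move=> s0 t0 /andP[d0 d1] sE.
have d20 : 0 < 1 - delta ^+ 2 by nra.
set r := Num.sqrt _; have r0 : 0 < r by rewrite sqrtr_gt0.
have r2 : r ^+ 2 = 1 - delta ^+ 2 by rewrite sqr_sqrtr// ltW.
pose s := tau * (1 - delta) / r.
have ss0 : 0 < s by rewrite divr_gt0// mulr_gt0// subr_gt0.
have s2 : s ^+ 2 = tau ^+ 2 * (1 - delta) / (1 + delta).
  rewrite /s exprMn exprVn r2; field.
  by apply/andP; split; lra.
set c := (X in _ = X * _).
have p0 := normal_pdf_gt0 0 x t0.
etransitivity; first exact: normal_ratioM_null_pdf.
apply: (mulIf (lt0r_neq0 p0)); rewrite divfK ?gt_eqF//.
rewrite /c !normal_pdf_expE//.
set w := Num.sqrt (2 * pi); have w0 : 0 < w := sqrt_2pi_gt0.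
transitivity ((sigma ^+ 2 * w ^+ 2)^-1 * expR (- (x - u) ^+ 2 / (sigma ^+ 2 *+ 2) +
   - (x - v) ^+ 2 / (sigma ^+ 2 *+ 2))).
  rewrite expRD; field; by rewrite !gt_eqF.
set e1 := (X in (r^-1 * expR X)).
set e2 := (X in _ * (_ * expR X) * (_ * expR _)).
set e3 := (X in _ * (_ * expR _) * (_ * expR X)).
transitivity ((r * s * tau * w ^+ 2)^-1 * expR (e1 + e2 + e3)); last first.
  rewrite !expRD -/s; field; by rewrite !gt_eqF.
(* The prefactors agree because [r * s * tau = tau ^+ 2 * (1 - delta) = sigma ^+ 2]; the exponents
   agree as rational functions. *)
congr (_^-1 * expR _).
  rewrite sE /s; field; by rewrite gt_eqF.
rewrite /e1 /e2 /e3 sE s2; field.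
by apply/and4P; split; rewrite ?gt_eqF//; lra.
Qed.

(** After completing the square, the integrand against Lebesgue measure is a constant times a normal
    density of total mass 1, so only the constant remains. *)
Lemma integral_normal_ratioM u v sigma tau delta : 0 < sigma -> 0 < tau ->
  0 <= delta < 1 -> sigma ^+ 2 = tau ^+ 2 * (1 - delta) ->
  (\int[normal_prob 0 tau]_x
     (normal_ratio u sigma tau x * normal_ratio v sigma tau x)%:E =
   ((Num.sqrt (1 - delta ^+ 2))^-1 *
    expR ((u * v - delta * (u ^+ 2 + v ^+ 2) / 2) /
          (tau ^+ 2 * (1 - delta ^+ 2))))%:E)%E.
Proof.
move=> s0 t0 d01 sE.
rewrite ge0_integral_normal_prob//; last 2 first.
- by apply/measurable_EFinP/measurable_funM; exact: measurable_normal_ratio.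
- by move=> x; rewrite lee_fin mulr_ge0// normal_ratio_ge0.
set c := (X in _ = X%:E).
have c0 : 0 <= c by rewrite mulr_ge0 ?invr_ge0 ?expR_ge0// ltW.
transitivity (\int[lebesgue_measure]_x (c%:E * (normal_pdf ((u + v) / (1 + delta))
    (tau * (1 - delta) / Num.sqrt (1 - delta ^+ 2)) x)%:E))%E.
  apply: eq_integral => x _; rewrite -!EFinM; congr EFin.
  exact: (normal_ratioM_pdf _ _ _ s0 t0 d01).
rewrite ge0_integralZl//; last 2 first.
- by apply/measurable_EFinP; exact: measurable_normal_pdf.
- by move=> x _; rewrite lee_fin normal_pdf_ge0.
by rewrite integral_normal_pdf mule1.
Qed.

End normal_likelihood_ratio.

(** * Elementary bounds on the exponential and the inverse square root *)

Section exponential_bounds.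
Import numFieldNormedType.Exports.
Context {R : realType}.
Implicit Types x y : R.

Lemma expR_le_quartic x : -1 <= x <= 1 ->
  expR x <= 1 + x + x ^+ 2 / 2 + x ^+ 3 / 6 + x ^+ 4 / 12.
Proof.
(* [g] decreases up to 0 and increases afterwards: [g'] has the sign of [y ^+ 3]. *)
pose g y : R := (1 + y + y ^+ 2 / 2 + y ^+ 3 / 6 + y ^+ 4 / 12) * expR (- y).
pose dg y : R := y ^+ 3 * (1 / 6 - y / 12) * expR (- y).
(* The first factor of [g] as a formal polynomial, so that its derivative is computed
   algebraically. *)
pose q : {poly R} := 1 + 'X + 2^-1 *: 'X^2 + 6^-1 *: 'X^3 + 12^-1 *: 'X^4.
have gd y : is_derive y 1 g (dg y).
  have -> : g = horner q * (expR \o -%R).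
    by apply/funext => z; rewrite /g /q fctE/= !(hornerD, hornerZ, hornerXn, hornerX, hornerC); congr (_ * _); field.
  apply: is_derive_eq.
  rewrite /dg /q /GRing.scale/= !(derivD, derivZ, derivXn, derivX, derivC) !(hornerD, hornerZ, hornerMn, hornerXn, hornerX, hornerC)/=; by field.
have gc (a b : R) : {within `[a, b], continuous g}.
  apply: continuous_subspaceT => z.
  by apply/differentiable_continuous/derivable1_diffP; have [] := gd z.
have g0 : g 0 = 1 by rewrite /g oppr0 expR0 !expr0n /=; lra.
move=> /andP[xm1 x1].
suff : 1 <= g x.
  rewrite /g expRN => /(ler_wpM2r (expR_ge0 x)).
  by rewrite mul1r divfK// gt_eqF// expR_gt0.
rewrite -g0.
have [x0|/ltW x0] := leP 0 x.
  have [c /[!in_itv]/= /andP[c0 cx]] := MVT_segment x0 (fun y _ => gd y) (gc 0 x).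
  move=> E; rewrite -subr_ge0 E subr0 !mulr_ge0// ?expR_ge0 ?exprn_ge0//; lra.
have [c /[!in_itv]/= /andP[c0 cx]] := MVT_segment x0 (fun y _ => gd y) (gc x 0).
move=> E; rewrite -subr_le0 E mulr_le0_ge0//; last lra.
rewrite /dg mulr_le0_ge0 ?expR_ge0// mulr_le0_ge0//; last lra.
by rewrite exprS mulr_le0_ge0// sqr_ge0.
Qed.

(** Averaging the bounds at [x] and [- x] cancels the odd terms. The coefficient 1/12 is twice that
    of the Taylor series, which absorbs the remainder. *)
Lemma cosh_le_quartic x : -1 <= x <= 1 ->
  (expR x + expR (- x)) / 2 <= 1 + x ^+ 2 / 2 + x ^+ 4 / 12.
Proof.
move=> x1; have := expR_le_quartic x1.
have /expR_le_quartic : -1 <= - x <= 1 by lra.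
rewrite !(exprS _ _) !expr0; nra.
Qed.

(** From [1 + x <= expR x] and [(1 + x) * (1 - x + x ^+ 2) = 1 + x ^+ 3 >= 1]. *)
Lemma expRN_le_quadratic x : 0 <= x -> expR (- x) <= 1 - x + x ^+ 2.
Proof.
move=> x0; have e := expR_ge1Dx x.
have : (1 + x)^-1 >= expR (- x) by rewrite expRN lef_pV2 ?posrE ?expR_gt0//; lra.
move/le_trans; apply; rewrite -div1r ler_pdivrMr; nra.
Qed.

Lemma invr_sqrt_le y : 0 <= y <= 1 / 2 ->
  (Num.sqrt (1 - y))^-1 <= 1 + y / 2 + y ^+ 2.
Proof.
move=> /andP[y0 y1].
have c0 : 0 < 1 + y / 2 + y ^+ 2 by nra.
rewrite -[leRHS]invrK lef_pV2 ?posrE ?invr_gt0 ?sqrtr_gt0//; last lra.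
rewrite -(@ler_pXn2r _ 2) ?nnegrE ?invr_ge0 ?sqrtr_ge0 ?(ltW c0)// sqr_sqrtr; last lra.
rewrite exprVn -div1r ler_pdivrMr ?exprn_gt0//.
(* After squaring, this is exactly the excess of [(1 - y) * (1 + y / 2 + y ^+ 2) ^+ 2] over 1. *)
have : 0 <= y ^+ 2 * (5/4 - 5/4 * y - y ^+ 3).
  rewrite mulr_ge0 ?sqr_ge0//; have : y ^+ 3 <= (1/2) ^+ 3 by rewrite lerXn2r ?nnegrE; lra.
  lra.
by rewrite !exprS !expr0; nra.
Qed.

End exponential_bounds.

(** * The prior on one coordinate and its second moment *)

Section three_point_prior.
Context {R : realType}.
Implicit Types (a p b sigma tau x : R).

(** Index [ord0] stands for the value 0, the other two for [a] and [- a]. Indexing by ['I_3] makes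
    the prior on vectors a finite sum over functions. *)
Definition atom a (s : 'I_3) : R := nth 0 [:: 0; a; - a] s.

Definition weight p (s : 'I_3) : R := nth 0 [:: 1 - p; p / 2; p / 2] s.

Lemma weight_ge0 p s : 0 <= p <= 1 -> 0 <= weight p s.
Proof.
move=> /andP[p0 p1].
by case: s => [[|[|[|//]]] i] /=; rewrite /weight/= ?subr_ge0// divr_ge0.
Qed.

Lemma sum_weight p : \sum_s weight p s = 1.
Proof. by rewrite !big_ord_recl big_ord0 /weight/=; lra. Qed.

(** The likelihood ratio, against N(0, tau^2), of one observation whose mean is drawn from the
    three-point prior. *)
Definition mixture_ratio p a sigma tau x : R :=
  \sum_s weight p s * normal_ratio (atom a s) sigma tau x.

Lemma mixture_ratio_ge0 p a sigma tau x : 0 <= p <= 1 ->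
  0 <= mixture_ratio p a sigma tau x.
Proof.
by move=> p01; apply: sumr_ge0 => s _; rewrite mulr_ge0 ?weight_ge0 ?normal_ratio_ge0.
Qed.

Lemma measurable_mixture_ratio p a sigma tau : 0 < tau ->
  measurable_fun setT (mixture_ratio p a sigma tau).
Proof.
move=> t0; apply: measurable_sum => s; apply: measurable_funM => //.
exact: measurable_normal_ratio.
Qed.

Lemma integral_mixture_ratio p a sigma tau : 0 <= p <= 1 -> 0 < tau ->
  (\int[normal_prob 0 tau]_x (mixture_ratio p a sigma tau x)%:E = 1)%E.
Proof.
move=> p01 t0.
have mr s : measurable_fun setT (normal_ratio (atom a s) sigma tau).
  exact: measurable_normal_ratio.
under eq_integral do rewrite /mixture_ratio -sumEFin.
rewrite ge0_integral_sum//; last 2 first.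
- by move=> s; apply/measurable_EFinP; apply: measurable_funM; [exact: measurable_cst|exact: mr].
- by move=> s x _; rewrite lee_fin; apply: mulr_ge0; rewrite ?weight_ge0 ?normal_ratio_ge0.
rewrite -[RHS]/(1%:E) -(sum_weight p) -sumEFin; apply: eq_bigr => s _.
under eq_integral do rewrite EFinM.
rewrite ge0_integralZl ?lee_fin ?weight_ge0//; last 2 first.
- by apply/measurable_EFinP; exact: mr.
- by move=> x _; rewrite lee_fin normal_ratio_ge0.
suff -> : (\int[normal_prob 0 tau]_x (normal_ratio (atom a s) sigma tau x)%:E = 1)%E.
  by rewrite mule1.
transitivity (\int[normal_prob (atom a s) sigma]_x 1)%E; last first.
  by rewrite integral_cst// mul1e; exact: probability_setT.
rewrite (@ge0_integral_normal_ratio R (atom a s) sigma tau (fun=> 1%E) t0).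
- by apply: eq_integral => x _; rewrite mul1e.
- exact: measurable_cst.
- by move=> x; exact: lee01.
Qed.

(* The second moment of the one-coordinate likelihood ratio: the three terms
   come from pairs of atoms with zero, one and two nonzero entries. *)
Definition overlap p b : R :=
  (Num.sqrt (1 - (p * b) ^+ 2))^-1 *
  ((1 - p) ^+ 2 + 2 * p * (1 - p) * expR (- (p * b * b / 2 / (1 - (p * b) ^+ 2))) +
   p ^+ 2 * ((expR (b / (1 - (p * b) ^+ 2)) + expR (- (b / (1 - (p * b) ^+ 2)))) / 2 *
     expR (- (p * b * b / (1 - (p * b) ^+ 2))))).

(** The square is expanded over pairs of atoms, and [integral_normal_ratioM] is applied with
    [delta = p * b]. This is the relative loss of noise variance for which
    [sigma ^+ 2 + p * a ^+ 2 = tau ^+ 2]. *)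
Lemma integral_mixture_ratio_sqr p a b sigma tau : 0 <= p <= 1 ->
  0 < sigma -> 0 < tau -> 0 <= b -> p * b < 1 -> a ^+ 2 = tau ^+ 2 * b ->
  sigma ^+ 2 = tau ^+ 2 * (1 - p * b) ->
  (\int[normal_prob 0 tau]_x (mixture_ratio p a sigma tau x ^+ 2)%:E =
   (overlap p b)%:E)%E.
Proof.
move=> p01 s0 t0 b0 pb1 aE sE.
have d01 : 0 <= p * b < 1 by rewrite mulr_ge0//; case/andP: p01.
have mr s : measurable_fun setT (normal_ratio (atom a s) sigma tau).
  exact: measurable_normal_ratio.
have r0 s x : 0 <= normal_ratio (atom a s) sigma tau x := normal_ratio_ge0 _ _ _ _.
have w0 s : 0 <= weight p s by exact: weight_ge0.
transitivity (\int[normal_prob 0 tau]_x \sum_s \sum_t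
   ((weight p s * weight p t)%:E * (normal_ratio (atom a s) sigma tau x *
     normal_ratio (atom a t) sigma tau x)%:E))%E.
  apply: eq_integral => x _; rewrite expr2 /mixture_ratio big_distrl/= -sumEFin.
  apply: eq_bigr => s _; rewrite big_distrr/= -sumEFin; apply: eq_bigr => t _.
  by rewrite -EFinM; congr EFin; rewrite mulrACA.
have mst s t : measurable_fun setT (fun x =>
    (weight p s * weight p t)%:E * (normal_ratio (atom a s) sigma tau x *
     normal_ratio (atom a t) sigma tau x)%:E)%E.
  by apply: emeasurable_funM => //; apply/measurable_EFinP; apply: measurable_funM.
have st0 s t x : (0 <= (weight p s * weight p t)%:E *
    (normal_ratio (atom a s) sigma tau x * normal_ratio (atom a t) sigma tau x)%:E)%E.
  by rewrite -EFinM lee_fin; exact: mulr_ge0 (mulr_ge0 (w0 s) (w0 t)) (mulr_ge0 (r0 s x) (r0 t x)).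
rewrite ge0_integral_sum//; last 2 first.
- by move=> s; apply: emeasurable_sum => t; exact: mst.
- by move=> s x _; apply: sume_ge0 => t _; exact: st0.
transitivity (\sum_s \sum_t (weight p s * weight p t)%:E *
   ((Num.sqrt (1 - (p * b) ^+ 2))^-1 *
    expR ((atom a s * atom a t - p * b * (atom a s ^+ 2 + atom a t ^+ 2) / 2) /
          (tau ^+ 2 * (1 - (p * b) ^+ 2))))%:E)%E.
  apply: eq_bigr => s _; rewrite ge0_integral_sum//; last by move=> t; exact: mst.
  apply: eq_bigr => t _; rewrite ge0_integralZl//; last 3 first.
  - by apply/measurable_EFinP; apply: measurable_funM; exact: mr.
  - by move=> x _; rewrite lee_fin; exact: mulr_ge0 (r0 s x) (r0 t x).
  - by rewrite lee_fin mulr_ge0.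
  by rewrite (integral_normal_ratioM _ _ s0 t0 d01 sE).
under eq_bigr => s _.
  under eq_bigr => t _ do rewrite -EFinM.
  rewrite sumEFin; over.
rewrite sumEFin; congr EFin.
have g0 : 0 < 1 - (p * b) ^+ 2 by case/andP: d01 => d0 d1; nra.
rewrite /overlap; set g := 1 - (p * b) ^+ 2 in g0 *; set r := (Num.sqrt g)^-1.
have tn0 : tau != 0 by rewrite gt_eqF.
have gn0 : g != 0 by rewrite gt_eqF.
rewrite !big_ord_recl !big_ord0 /weight /atom/= !(mul0r, mulr0, expr0n, addr0, add0r, subr0, sub0r, mulrN, mulNr, sqrrN, opprK)/=.
(* Exponents for pairs with one zero atom ([e0]), with equal nonzero atoms ([e1]) and with opposite
   nonzero atoms ([e2]). *)
have e0 : - (p * b * a ^+ 2 / 2 / (tau ^+ 2 * g)) = - (p * b * b / 2 / g).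
  by rewrite aE; field; rewrite ?tn0 ?gn0.
have e1 : (a * a - p * b * (a ^+ 2 + a ^+ 2) / 2) / (tau ^+ 2 * g) = b / g - p * b * b / g.
  by rewrite -expr2 aE; field; rewrite ?tn0 ?gn0.
have e2 : (- (a * a) - p * b * (a ^+ 2 + a ^+ 2) / 2) / (tau ^+ 2 * g) = - (b / g) - p * b * b / g.
  by rewrite -expr2 aE; field; rewrite ?tn0 ?gn0.
rewrite e0 e1 e2 oppr0 expR0 !expRD.
by field.
Qed.

(** With [d = p * b], the bracket is at most 1 - d^2/2 up to a multiple of p^2 b^4, and the inverse
    square root at most 1 + d^2/2 + d^4. The terms in d^2 cancel, since the variances match, and d^4
    <= p^2 b^4. *)
Lemma overlap_le p b : 0 <= p <= 1 -> 0 <= b <= 1 / 2 ->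
  overlap p b <= 1 + 7 * (p ^+ 2 * b ^+ 4).
Proof.
move=> /andP[p0 p1] /andP[b0 b1].
set d := p * b; have d0 : 0 <= d by rewrite mulr_ge0.
have db : d <= b by rewrite ler_piMl.
have y1 : d ^+ 2 <= 1 / 4 by rewrite expr2; nra.
have y0 : 0 <= d ^+ 2 by rewrite sqr_ge0.
rewrite /overlap -/d; set g := 1 - d ^+ 2; have g34 : 3 / 4 <= g by rewrite /g; lra.
have g1 : g <= 1 by rewrite /g; lra.
have g0 : 0 < g by lra.
have bg x : 0 <= x -> x <= x / g by move=> x0; rewrite ler_pdivlMr// ler_piMr.
have A1 : expR (- (d * b / 2 / g)) <= 1 - d * b / 2 + (d * b / 2) ^+ 2.
  apply: le_trans (expRN_le_quadratic _); last by rewrite divr_ge0// mulr_ge0.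
  by rewrite ler_expR lerN2 bg// divr_ge0// mulr_ge0.
have A3 : expR (- (d * b / g)) <= 1 - d * b + (d * b) ^+ 2.
  apply: le_trans (expRN_le_quadratic _); last by rewrite mulr_ge0.
  by rewrite ler_expR lerN2 bg// mulr_ge0.
have bg23 : b / g <= 4 / 3 * b by rewrite ler_pdivrMr//; nra.
have bg0 : 0 <= b / g by rewrite divr_ge0// ltW.
have A2 : (expR (b / g) + expR (- (b / g))) / 2 <= 1 + b ^+ 2 / 2 + 3 * b ^+ 4.
  apply: (le_trans (cosh_le_quartic _)); first lra.
  have h1 : (b / g) ^+ 4 <= (4 / 3 * b) ^+ 4 by rewrite lerXn2r ?nnegrE//; lra.
  (* The quadratic term must keep its coefficient 1/2 for the later cancellation, so the crude bound
     by 4/3 used for the quartic term does not do. Here [1 / g ^+ 2 <= 1 + 4 * d ^+ 2], whose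
     correction is of order [b ^+ 4]. *)
  have h2 : (b / g) ^+ 2 <= b ^+ 2 * (1 + 4 * d ^+ 2).
    rewrite exprMn ler_wpM2l ?sqr_ge0// exprVn -div1r ler_pdivrMr ?exprn_gt0//.
    rewrite /g; set y := d ^+ 2 in y0 y1 *.
    rewrite -subr_ge0 (_ : _ - _ = y * (2 - 7 * y + 4 * y ^+ 2)); last by field.
    by rewrite mulr_ge0//; nra.
  have h3 : b ^+ 2 * d ^+ 2 <= b ^+ 4.
    by rewrite -[4%N]/(2 + 2)%N exprD ler_wpM2l ?sqr_ge0// lerXn2r ?nnegrE.
  have b4 : 0 <= b ^+ 4 by rewrite exprn_ge0.
  move: h1; rewrite exprMn; lra.
have A0 : 0 <= (expR (b / g) + expR (- (b / g))) / 2.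
  by rewrite divr_ge0// addr_ge0// expR_ge0.
have S : (1 - p) ^+ 2 + 2 * p * (1 - p) * expR (- (d * b / 2 / g)) +
   p ^+ 2 * ((expR (b / g) + expR (- (b / g))) / 2 * expR (- (d * b / g))) <=
   1 - d ^+ 2 / 2 + 9 / 2 * (p ^+ 2 * b ^+ 4).
  apply: (@le_trans _ _ ((1 - p) ^+ 2 + 2 * p * (1 - p) * (1 - d * b / 2 + (d * b / 2) ^+ 2) +
   p ^+ 2 * ((1 + b ^+ 2 / 2 + 3 * b ^+ 4) * (1 - d * b + (d * b) ^+ 2)))).
    apply: lerD; first by rewrite lerD2l ler_wpM2l// !mulr_ge0// subr_ge0.
    by rewrite ler_wpM2l ?sqr_ge0// ler_pM ?expR_ge0.
  rewrite -subr_ge0 (_ : _ - _ = p ^+ 2 * b ^+ 4 * (3 / 2 - p / 2 - p ^+ 2 / 2) +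
     p ^+ 2 * (b ^+ 2 / 2 + 3 * b ^+ 4) * (p * b ^+ 2 * (1 - p * b ^+ 2))); last first.
    by rewrite /d; field.
  have pb : p * b ^+ 2 <= 1 by rewrite expr2; nra.
  rewrite addr_ge0// !mulr_ge0 ?sqr_ge0 ?exprn_ge0 ?subr_ge0//; first nra.
  by rewrite addr_ge0// mulr_ge0 ?exprn_ge0.
have r1 := @invr_sqrt_le R (d ^+ 2).
have {}r1 : (Num.sqrt g)^-1 <= 1 + d ^+ 2 / 2 + (d ^+ 2) ^+ 2 by apply: r1; lra.
set x := p ^+ 2 * b ^+ 4 in S *.
have x0 : 0 <= x by rewrite mulr_ge0 ?exprn_ge0.
have d4 : (d ^+ 2) ^+ 2 <= x.
  rewrite /x /d (_ : _ ^+ 2 = p ^+ 2 * (p ^+ 2 * b ^+ 4)); last by ring.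
  by rewrite ler_piMl// exprn_ile1.
set y := d ^+ 2 in y0 y1 S r1 d4 *.
apply: (@le_trans _ _ ((1 + y / 2 + y ^+ 2) * (1 - y / 2 + 9 / 2 * x))).
  apply: ler_pM => //.
  by rewrite !addr_ge0 ?sqr_ge0// mulr_ge0 ?sqr_ge0// mulr_ge0 ?expR_ge0// ?mulr_ge0// subr_ge0.
have y2 : y ^+ 2 <= 1 / 16 by rewrite expr2; nra.
have xy : x * (y / 2 + y ^+ 2) <= x * (3 / 16) by rewrite ler_wpM2l//; lra.
have y3 : 0 <= y ^+ 3 by rewrite exprn_ge0.
(* With [y ^+ 2 <= x], the coefficient of [x] is at most 3/4 + 9/2 + 27/32 < 7. *)
rewrite [leLHS](_ : _ = 1 + 3 / 4 * y ^+ 2 - y ^+ 3 / 2 + 9 / 2 * x + 9 / 2 * (x * (y / 2 + y ^+ 2))); last by field.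
lra.
Qed.

End three_point_prior.

(** * The prior on vectors: mixture density, number of nonzero entries, separation *)

Section product_prior.
Context {R : realType} {n : nat}.
Implicit Types (a p sigma tau : R) (f : {ffun 'I_n -> 'I_3}).

Definition prior p f : R := \prod_i weight p (f i).

Definition signal a f : 'rV[R]_n := \row_i atom a (f i).

Lemma prior_ge0 p f : 0 <= p <= 1 -> 0 <= prior p f.
Proof. by move=> p01; apply: prodr_ge0 => i _; exact: weight_ge0. Qed.

Lemma sum_prior p : \sum_f prior p f = 1.
Proof.
rewrite -(bigA_distr_bigA (fun _ => weight p)) big1// => i _.
exact: sum_weight.
Qed.

Lemma gauss_law0E tau :
  gauss_law (0 : 'rV[R]_n) tau = tuple_prodP (fun=> normal_prob 0 tau).
Proof.
apply: (congr1 (fun m : 'I_n -> probability (measurableTypeR R) R => tuple_prodP m)).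
by apply/funext => i; rewrite mxE.
Qed.

Lemma measurable_prod_mixture_ratio p a sigma tau : 0 < tau ->
  measurable_fun setT (fun y : n.-tuple (measurableTypeR R) =>
    \prod_i mixture_ratio p a sigma tau (tnth y i)).
Proof.
move=> t0; apply: (@measurable_prod_tnth _ _ R n (fun=> mixture_ratio p a sigma tau)).
by move=> _; exact: measurable_mixture_ratio.
Qed.

Lemma gauss_law_signalE a f sigma tau A : 0 < tau -> measurable A ->
  (gauss_law (signal a f) sigma A = \int[gauss_law (0 : 'rV[R]_n) tau]_(y in A)
    (\prod_i normal_ratio (atom a (f i)) sigma tau (tnth y i))%:E)%E.
Proof.
move=> t0 mA; rewrite gauss_law0E.
transitivity (\int[gauss_law (signal a f) sigma]_y (\1_A y)%:E)%E.
  by rewrite integral_indic// setIT.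
rewrite /gauss_law (@ge0_integral_tuple_prodP_density _ _ _ _ (fun=> normal_prob 0 tau) _
  (fun i => normal_ratio (atom a (f i)) sigma tau)).
- rewrite [RHS]integral_mkcond; apply: eq_integral => y _; rewrite patchE indicE.
  by case: (_ \in _); rewrite ?mul1e ?mul0e.
- by move=> i; exact: measurable_normal_ratio.
- by move=> i x; exact: normal_ratio_ge0.
- by move=> i g mg g0; rewrite mxE; exact: ge0_integral_normal_ratio.
- by apply/measurable_EFinP; exact: measurable_indic.
- by move=> y; rewrite lee_fin.
Qed.

(** Expanding the product over coordinates of sums over atoms gives the prior average of the
    likelihood ratios, so this product is the density of the mixture against the null. *)
Lemma sum_prior_gauss_law p a sigma tau A : 0 <= p <= 1 -> 0 < tau ->
  measurable A ->
  (\sum_f (prior p f)%:E * gauss_law (signal a f) sigma A =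
   \int[gauss_law (0 : 'rV[R]_n) tau]_(y in A)
     (\prod_i mixture_ratio p a sigma tau (tnth y i))%:E)%E.
Proof.
move=> p01 t0 mA.
have mf f : measurable_fun A (fun y : n.-tuple (measurableTypeR R) =>
    (\prod_i normal_ratio (atom a (f i)) sigma tau (tnth y i))%:E).
  apply/measurable_EFinP; apply: measurable_funTS.
  apply: (@measurable_prod_tnth _ _ R n (fun i => normal_ratio (atom a (f i)) sigma tau)).
  by move=> i; exact: measurable_normal_ratio.
have f0 f (y : n.-tuple (measurableTypeR R)) : A y ->
    (0 <= (\prod_i normal_ratio (atom a (f i)) sigma tau (tnth y i))%:E)%E.
  by move=> _; rewrite lee_fin; apply: prodr_ge0 => i _; exact: normal_ratio_ge0.
transitivity (\sum_f \int[gauss_law (0 : 'rV[R]_n) tau]_(y in A) ((prior p f)%:E *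
    (\prod_i normal_ratio (atom a (f i)) sigma tau (tnth y i))%:E))%E.
  apply: eq_bigr => f _; rewrite (gauss_law_signalE _ _ _ t0 mA) ge0_integralZl//.
  - by move=> y; exact: f0.
  - by rewrite lee_fin prior_ge0.
rewrite -ge0_integral_sum//.
- apply: eq_integral => y _; rewrite /mixture_ratio.
  rewrite (bigA_distr_bigA (fun i s => weight p s * normal_ratio (atom a s) sigma tau (tnth y i))).
  rewrite -sumEFin; apply: eq_bigr => f _.
  by rewrite -EFinM /prior -big_split.
- by move=> f; apply: emeasurable_funM.
- by move=> f y Ay; rewrite mule_ge0 ?f0// lee_fin prior_ge0.
Qed.

Definition nonzeros f : nat := \sum_i (f i != ord0).

Let dev p (s : 'I_3) : R := (s != ord0)%:R - p.

Let sum_dev p : \sum_s weight p s * dev p s = 0.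
Proof. by rewrite !big_ord_recl big_ord0 /weight /dev/=; lra. Qed.

Let sum_dev2 p : \sum_s weight p s * dev p s * dev p s = p * (1 - p).
Proof. by rewrite !big_ord_recl big_ord0 /weight /dev/=; lra. Qed.

Let sum_prior_dev2 p i j :
  \sum_f prior p f * (dev p (f i) * dev p (f j)) = (p * (1 - p)) *+ (i == j).
Proof.
(* The deviations are inserted into the factors of coordinates [i] and [j], so that the expectation
   factorizes. For [i != j] the factor of [i] has mean 0; for [i = j] both deviations fall into one
   factor. *)
pose F (k : 'I_n) s := weight p s * (if k == i then dev p s else 1) *
  (if k == j then dev p s else 1).
transitivity (\sum_(f : {ffun 'I_n -> 'I_3}) \prod_k F k (f k)).
  apply: eq_bigr => f _; rewrite /F !big_split/= mulrA; congr (_ * _ * _).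
    by rewrite -big_mkcond big_pred1_eq.
  by rewrite -big_mkcond big_pred1_eq.
rewrite -bigA_distr_bigA (bigD1 i)//= {1}/F eqxx.
have [eij|ij] := eqVneq i j; last first.
  by under eq_bigr do rewrite mulr1; rewrite sum_dev mul0r.
rewrite sum_dev2 big1 ?mulr1// => k kj.
by rewrite /F -eij (negbTE kj); under eq_bigr do rewrite !mulr1; rewrite sum_weight.
Qed.

(** The centred count is a sum of uncorrelated deviations, so only the diagonal of the expanded
    square contributes. *)
Lemma prior_variance p :
  \sum_f prior p f * ((nonzeros f)%:R - n%:R * p) ^+ 2 = n%:R * (p * (1 - p)).
Proof.
transitivity (\sum_f \sum_i \sum_j prior p f * (dev p (f i) * dev p (f j))).
  apply: eq_bigr => f _.
  have -> : (nonzeros f)%:R - n%:R * p = \sum_i dev p (f i).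
    by rewrite /dev big_split/= sumr_const card_ord mulNrn mulr_natl natr_sum.
  rewrite expr2 big_distrl/= big_distrr/=; apply: eq_bigr => i _.
  by rewrite !big_distrr.
rewrite exchange_big/=; under eq_bigr do rewrite exchange_big/=.
under eq_bigr => i _.
  under eq_bigr => j _ do rewrite sum_prior_dev2.
  rewrite (bigD1 i)//= eqxx big1 ?addr0; last first.
    by move=> j ji; rewrite eq_sym (negbTE ji).
  over.
by rewrite sumr_const card_ord mulr_natl.
Qed.

Lemma prior_chebyshev p t : 0 <= p <= 1 -> 0 < t ->
  \sum_(f | t <= `|(nonzeros f)%:R - n%:R * p|) prior p f <= n%:R * p / t ^+ 2.
Proof.
move=> p01 t0; rewrite ler_pdivlMr ?exprn_gt0//.
apply: (@le_trans _ _ (n%:R * (p * (1 - p)))); last first.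
  by rewrite ler_wpM2l// ler_piMr; case/andP: p01 => *; lra.
rewrite -prior_variance big_distrl/= big_mkcond/=.
apply: ler_sum => f _; case: ifPn => [h|_]; last first.
  by rewrite mulr_ge0 ?prior_ge0 ?sqr_ge0.
rewrite ler_wpM2l ?prior_ge0// -[leRHS]real_normK ?num_real//.
by rewrite lerXn2r ?nnegrE// ltW.
Qed.

Lemma l0norm_signal a f : a != 0 -> l0norm (signal a f) = nonzeros f.
Proof.
move=> a0; rewrite /l0norm /nonzeros -sum1_card big_mkcond/=.
apply: eq_bigr => i _; rewrite inE mxE /atom.
by case: (f i) => [[|[|[|//]]] h]; rewrite /= ?eqxx ?oppr_eq0 ?a0.
Qed.

(** A [k0]-sparse vector vanishes on at least [l0norm theta - k0] positions of the support of
    [theta], and each of them adds at least [a ^+ 2] to the squared distance. *)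
Lemma le_d2_set_sparse_ball (theta : 'rV[R]_n) k0 a rho : 0 <= rho ->
  (forall i, theta ord0 i != 0 -> a ^+ 2 <= theta ord0 i ^+ 2) ->
  rho ^+ 2 <= (l0norm theta - k0)%:R * a ^+ 2 ->
  rho <= d2_set theta (sparse_ball k0).
Proof.
move=> rho0 ha hrho; apply: lb_le_inf.
  (* The vector 0 shows that the set of distances is nonempty, as required to bound its [inf] from
     below. *)
  exists (d2 theta 0), 0 => //=; rewrite /sparse_ball/= /l0norm.
  by rewrite (eq_card0 (_ : _ =i pred0))// => i; rewrite !inE mxE eqxx.
move=> _ [u /= uk <-].
rewrite /d2 -(ger0_norm rho0) -sqrtr_sqr; apply: ler_wsqrtr.
apply: (le_trans hrho).
pose A := [set i | theta ord0 i != 0]%SET; pose B := [set i | u ord0 i != 0]%SET.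
have cAB : (l0norm theta - k0 <= #|A :\: B|)%N.
  rewrite leq_subLR {1}/l0norm -/A -(cardsID B A) leq_add2r (leq_trans _ uk)//.
  by rewrite subset_leq_card// subsetIr.
apply: (@le_trans _ _ (#|A :\: B|%:R * a ^+ 2)).
  by rewrite ler_wpM2r ?sqr_ge0// ler_nat.
rewrite mulr_natl -sumr_const big_mkcond/=; apply: ler_sum => i _.
case: ifPn => [|_]; last by rewrite sqr_ge0.
by rewrite !inE negbK => /andP[/eqP -> /ha]; rewrite subr0.
Qed.

End product_prior.

(** * Lower bound on the risk of every test *)

Section lower_bound.
Context {R : realType} {n : nat}.
Implicit Types (a p sigma tau : R).

Lemma sup_ge0_ubound (S : set (\bar R)) x : S x -> (x <= sup_ge0 S)%E.
Proof. by move=> Sx; apply: ereal_sup_ubound; right. Qed.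

Lemma sup_ge0_ge0 (S : set (\bar R)) : (0 <= sup_ge0 S)%E.
Proof. by apply: ereal_sup_ubound; left. Qed.

(** By independence the second moment is the [n]-th power of [overlap p b], at most exp(1/50) <=
    50/49 <= 1 + 1/25. The form of the bound suits [le_probability_chi_square] with [t = 1 / 5]. *)
Lemma integral_prod_mixture_ratio_sqr_le p a b sigma tau : 0 <= p <= 1 ->
  0 < sigma -> 0 < tau -> 0 <= b <= 1 / 2 -> a ^+ 2 = tau ^+ 2 * b ->
  sigma ^+ 2 = tau ^+ 2 * (1 - p * b) ->
  n%:R * (7 * (p ^+ 2 * b ^+ 4)) <= 1 / 50 ->
  (\int[gauss_law (0 : 'rV[R]_n) tau]_y
     ((\prod_i mixture_ratio p a sigma tau (tnth y i)) ^+ 2)%:E <=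
   (1 + (1 / 5) ^+ 2)%:E)%E.
Proof.
move=> p01 s0 t0 b01 aE sE small.
have b0 : 0 <= b by case/andP: b01.
have pb1 : p * b < 1 by case/andP: p01 => *; case/andP: b01 => *; nra.
under eq_integral do rewrite -prodrXl.
rewrite gauss_law0E.
rewrite [leLHS](_ : _ =
    \prod_(i < n) \int[normal_prob 0 tau]_x (mixture_ratio p a sigma tau x ^+ 2)%:E)%E; last first.
  apply: (@ge0_integral_tuple_prodP_prod _ _ R n (fun=> normal_prob 0 tau)
    (fun _ x => mixture_ratio p a sigma tau x ^+ 2)).
    by move=> _; apply: measurable_funX; exact: measurable_mixture_ratio.
  by move=> _ x; exact: sqr_ge0.
under eq_bigr do rewrite (integral_mixture_ratio_sqr p01 s0 t0 b0 pb1 aE sE).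
rewrite prodEFin lee_fin prodr_const card_ord.
set x := 7 * (p ^+ 2 * b ^+ 4) in small.
have K0 : 0 <= overlap p b.
  rewrite /overlap mulr_ge0 ?invr_ge0 ?sqrtr_ge0//.
  have [p0 p1] := andP p01.
  by rewrite !addr_ge0 ?sqr_ge0// mulr_ge0 ?sqr_ge0 ?expR_ge0// ?mulr_ge0 ?subr_ge0//
    ?mulr_ge0 ?addr_ge0 ?expR_ge0.
apply: (@le_trans _ _ (expR (n%:R * x))).
  rewrite expRM_natl lerXn2r ?nnegrE ?expR_ge0//.
  exact: le_trans (overlap_le p01 b01) (expR_ge1Dx _).
apply: (@le_trans _ _ (expR (1 / 50))); first by rewrite ler_expR.
have := @expR_ge1Dx R (- (1 / 50)); rewrite expRN => h.
have e0 := expR_gt0 (1 / 50 : R).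
have : (1 - 1 / 50) * expR (1 / 50) <= 1 :> R by rewrite -ler_pdivlMr// [leRHS]div1r.
by rewrite expr2; lra.
Qed.

(** With S1 and S2 the two suprema of the risk, 1 = P0(T = 1) + P0(T = 0) <= S1 + (1/2 + S2) + 1/5.
    The 1/5 is the chi-square loss, and 1/2 bounds the prior mass of signals not known to lie in the
    alternative. *)
Lemma R_var_ge (sigma_m sigma_p sigma a b p rho t : R) (k0 Delta : nat)
    (T : {mfun n.-tuple (measurableTypeR R) >-> bool}) :
  0 <= p <= 1 -> 0 < sigma -> sigma_m <= sigma -> sigma <= sigma_p ->
  0 <= b <= 1 / 2 ->
  a ^+ 2 = sigma_p ^+ 2 * b -> sigma ^+ 2 = sigma_p ^+ 2 * (1 - p * b) ->
  n%:R * (7 * (p ^+ 2 * b ^+ 4)) <= 1 / 50 ->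
  0 < t -> n%:R * p / t ^+ 2 <= 1 / 2 ->
  (forall f : {ffun 'I_n -> 'I_3}, `|(nonzeros f)%:R - n%:R * p| < t ->
    sparse_ball_away (k0 + Delta) k0 rho (signal a f)) ->
  ((3 / 10)%:E <= R_var sigma_m sigma_p T k0 Delta rho)%E.
Proof.
move=> p01 s0 sm sp b01 aE sE small t0 cheb good; rewrite /R_var.
set S1 := sup_ge0 _; set S2 := sup_ge0 _.
have sp0 : 0 < sigma_p by exact: lt_le_trans sp.
have S10 : (0 <= S1)%E by exact: sup_ge0_ge0.
have S20 : (0 <= S2)%E by exact: sup_ge0_ge0.
pose A1 := [set y : n.-tuple (measurableTypeR R) | T y = true].
pose A0 := [set y : n.-tuple (measurableTypeR R) | T y = false].
have mT : measurable_fun setT T by exact: measurable_funP.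
have mA1 : measurable A1 by rewrite -[A1]setTI; exact: (mT measurableT [set true]).
have mA0 : measurable A0 by rewrite -[A0]setTI; exact: (mT measurableT [set false]).
pose P0 := gauss_law (0 : 'rV[R]_n) sigma_p.
have h1 : (P0 A1 <= S1)%E.
  apply: sup_ge0_ubound; exists 0.
    by rewrite /sparse_ball/= /l0norm eq_card0// => i; rewrite !inE mxE eqxx.
  by exists sigma_p => //; rewrite /= in_itv/= lexx andbT; exact: le_trans sm sp.
pose L (y : n.-tuple (measurableTypeR R)) : R :=
  \prod_i mixture_ratio p a sigma sigma_p (tnth y i).
have mL : measurable_fun setT L.
  exact: measurable_prod_mixture_ratio.
have L0 y : 0 <= L y by apply: prodr_ge0 => i _; exact: mixture_ratio_ge0.
have L1 : (\int[P0]_y (L y)%:E = 1)%E.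
  rewrite /P0 gauss_law0E; etransitivity.
    apply: (@ge0_integral_tuple_prodP_prod _ _ R n (fun=> normal_prob 0 sigma_p)
      (fun=> mixture_ratio p a sigma sigma_p)).
      by move=> _; exact: measurable_mixture_ratio.
    by move=> _ x; exact: mixture_ratio_ge0.
  by rewrite big1// => i _; exact: integral_mixture_ratio.
have h0 : (P0 A0 <= \int[P0]_(y in A0) (L y)%:E + (1 / 5)%:E)%E.
  apply: le_probability_chi_square => //.
  exact: integral_prod_mixture_ratio_sqr_le small.
pose bad (f : {ffun 'I_n -> 'I_3}) := t <= `|(nonzeros f)%:R - n%:R * p|.
have hmix : (\int[P0]_(y in A0) (L y)%:E <= (1 / 2)%:E + S2)%E.
  rewrite -(sum_prior_gauss_law _ _ p01 sp0 mA0).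
  rewrite (bigID bad)/=.
  apply: leeD.
    apply: (@le_trans _ _ (\sum_(f | bad f) (prior p f)%:E)%E).
      apply: lee_sum => f _.
      by rewrite -[leRHS]mule1 lee_wpmul2l ?lee_fin ?prior_ge0// probability_le1.
    by rewrite sumEFin lee_fin (le_trans (prior_chebyshev p01 t0)).
  apply: (@le_trans _ _ (\sum_(f | ~~ bad f) (prior p f)%:E * S2)%E).
    apply: lee_sum => f; rewrite /bad -ltNge => hf.
    rewrite lee_wpmul2l ?lee_fin ?prior_ge0//.
    apply: sup_ge0_ubound; exists (signal a f); first exact: good.
    by exists sigma => //; rewrite /= in_itv/= sm.
  rewrite -ge0_sume_distrl; last by move=> f _; rewrite lee_fin prior_ge0.
  rewrite -[leRHS]mul1e lee_wpmul2r// sumEFin lee_fin -(@sum_prior R n p).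
  by rewrite big_mkcond/=; apply: ler_sum => f _; case: ifPn => // _; rewrite prior_ge0.
have PU : (P0 A1 + P0 A0 = 1)%E.
  rewrite -measureU//; last first.
    by apply/seteqP; split=> y //= [Ty1]; rewrite /A0/= (Ty1 : T y = true).
  rewrite (_ : A1 `|` A0 = setT); first exact: probability_setT.
  by apply/seteqP; split=> y //= _; rewrite /A1 /A0/=; case: (T y); [left|right].
have : (1 <= S1 + ((1 / 2)%:E + S2 + (1 / 5)%:E))%E.
  by rewrite -PU leeD// (le_trans h0)// leeD2r.
move: S10 S20; case: S1 {h1} => [r1| |]; case: S2 {hmix} => [r2| |] //=.
  by rewrite -!EFinD !lee_fin; lra.
all: by move=> *; exact: leey.
Qed.

End lower_bound.

(** * Choice of the parameters and conclusion *)

Theorem theorem3 (R : realType) (q : R) (hq : 0 < q < 1) :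
  exists c : R, 0 < c /\
    forall (sigma_m sigma_p : R) (n k0 Delta : nat) (gamma : R),
      0 < sigma_m -> sigma_m <= q * sigma_p ->
      0 <= gamma <= 25 / 100 ->
      k0%:R <= Num.sqrt (n%:R : R) ->
      Num.max (Num.sqrt (n%:R : R)) 48 <= Delta%:R ->
      (Delta <= n - k0)%N ->
      ((c * sigma_p ^+ 2 * Num.sqrt (Delta%:R * Num.sqrt n%:R))%:E
        <= rho_star_var n sigma_m sigma_p gamma k0 Delta ^+ 2)%E.
Proof.
have [q0 q1] := andP hq.
(* Since [p * b <= eps <= 1 - q ^+ 2], the alternative noise level stays above [q * sigma_p], hence
   above [sigma_m]; and [eps <= 1 / 10] makes the second moment small enough. *)
pose eps : R := (1 - q ^+ 2) / 10.
have eps0 : 0 < eps by rewrite /eps divr_gt0// subr_gt0 expr_lt1// ltW.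
have eps1 : eps <= 1 / 10 by rewrite /eps; have := sqr_ge0 q; lra.
(* The signals used have at least Delta/4 nonzero entries beyond [k0], each of square
   [eps * v * sigma_p ^+ 2] with [v] as below; the product is the claimed rate because
   [D * v = Num.sqrt (D * s)]. *)
exists (eps / 4); split; first by rewrite divr_gt0.
move=> sigma_m sigma_p n k0 Delta gamma sm0 smq /andP[_ g1] hk; rewrite ge_max => /andP[hs h48] hD.
have sp0 : 0 < sigma_p by rewrite -(pmulr_rgt0 _ q0) (lt_le_trans sm0).
set s : R := Num.sqrt n%:R in hk hs *.
set D : R := Delta%:R in hs h48 *.
have D0 : 0 < D by lra.
have kDn : (k0%:R + D <= n%:R :> R).
  (* The subtraction in [n - k0] is truncated; as [n - k0] is at least Delta > 0, it is a genuine
     difference. *)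
  have kn : (k0 <= n)%N.
    have : (0 < n - k0)%N by apply: leq_trans hD; rewrite -(ltr0n R).
    by rewrite subn_gt0 => /ltnW.
  by rewrite /D -natrD ler_nat -leq_subRL.
have k00 : 0 <= k0%:R :> R by [].
have n0 : 0 < n%:R :> R by lra.
have s0 : 0 < s by rewrite sqrtr_gt0.
have s2 : s ^+ 2 = n%:R by rewrite sqr_sqrtr// ltW.
pose v := Num.sqrt (s / D).
have v0 : 0 < v by rewrite sqrtr_gt0 divr_gt0.
have v2 : v ^+ 2 = s / D by rewrite sqr_sqrtr// divr_ge0 ?ltW.
have v1 : v <= 1.
  by rewrite -[leRHS]sqrtr1; apply: ler_wsqrtr; rewrite ler_pdivrMr// mul1r.
pose b := eps * v.
have b0 : 0 < b by rewrite mulr_gt0.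
have beps : b <= eps by rewrite ler_piMr// ltW.
pose p := (k0%:R + D / 2) / n%:R.
have npE : n%:R * p = k0%:R + D / 2 by rewrite /p mulrC divfK ?gt_eqF.
have p0 : 0 <= p by rewrite divr_ge0// ?addr_ge0 ?divr_ge0// ltW.
have p1 : p <= 1 by rewrite ler_pdivrMr// mul1r; lra.
have pbeps : p * b <= eps by apply: le_trans beps; rewrite ler_piMl// ltW.
have qpb : q ^+ 2 <= 1 - p * b by move: pbeps eps0; rewrite /eps; lra.
pose sigma := sigma_p * Num.sqrt (1 - p * b).
pose a := sigma_p * Num.sqrt b.
pose rho := Num.sqrt (eps / 4 * sigma_p ^+ 2 * Num.sqrt (D * s)).
have r20 : 0 < eps / 4 * sigma_p ^+ 2 * Num.sqrt (D * s).
  have DS : 0 < D * s by rewrite mulr_gt0.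
  by rewrite mulr_gt0 ?sqrtr_gt0// mulr_gt0 ?exprn_gt0// divr_gt0.
have rho0 : 0 < rho by rewrite sqrtr_gt0.
have rho2 : rho ^+ 2 = eps / 4 * sigma_p ^+ 2 * Num.sqrt (D * s) by rewrite sqr_sqrtr// ltW.
have pb0 : 0 <= p * b by rewrite mulr_ge0// ltW.
have a2 : a ^+ 2 = sigma_p ^+ 2 * b by rewrite exprMn sqr_sqrtr// ltW.
have a0 : a != 0 by rewrite gt_eqF// mulr_gt0// sqrtr_gt0.
have Dv : D * v = Num.sqrt (D * s).
  rewrite /v -{1}(ger0_norm (ltW D0)) -sqrtr_sqr -sqrtrM ?sqr_ge0//; congr Num.sqrt.
  by field; rewrite gt_eqF.
suff : (rho%:E <= rho_star_var n sigma_m sigma_p gamma k0 Delta)%E.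
  move=> h; rewrite -rho2 EFin_expe.
  by rewrite !expe2 lee_pmul// lee_fin ltW.
apply: le_ereal_inf_tmp => _ [T _ <-].
(* For each test it suffices that the risk at this single [rho] exceeds [gamma]; it is at least 3/10
   > 25/100. *)
apply: sup_ge0_ubound; exists rho => //=; split => //.
apply: (@lt_le_trans _ _ (3 / 10)%:E); first by rewrite lte_fin; lra.
apply: (@R_var_ge R n sigma_m sigma_p sigma a b p rho (D / 4)).
- by rewrite p0.
- by rewrite mulr_gt0// sqrtr_gt0; move: qpb (exprn_gt0 2 q0); lra.
- apply: (le_trans smq); rewrite mulrC ler_wpM2l ?(ltW sp0)//.
  by rewrite -(ger0_norm (ltW q0)) -sqrtr_sqr; apply: ler_wsqrtr.
- rewrite ler_piMr ?(ltW sp0)// -[leRHS]sqrtr1; apply: ler_wsqrtr; lra.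
- by rewrite (ltW b0)/=; lra.
- exact: a2.
- by rewrite exprMn sqr_sqrtr// (le_trans _ qpb)// sqr_ge0.
(* Here [k0 <= s <= D] gives [n%:R * p <= 3 / 2 * D], and [b ^+ 4] is of order n / D^2, so all
   powers of [n] and [D] cancel. *)
- have pD : p <= 3 / 2 * D / n%:R by rewrite ler_pM2r ?invr_gt0//; lra.
  have p2 : p ^+ 2 <= (3 / 2 * D / n%:R) ^+ 2.
    by rewrite lerXn2r ?nnegrE// (le_trans p0).
  have b4 : b ^+ 4 = eps ^+ 4 * (n%:R / D ^+ 2).
    rewrite /b -s2 (_ : (eps * v) ^+ 4 = eps ^+ 4 * (v ^+ 2) ^+ 2); last by ring.
    by rewrite v2 (expr_div_n s D).
  have e4 : eps ^+ 4 <= (1 / 10) ^+ 4 by rewrite lerXn2r ?nnegrE// ltW.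
  apply: (@le_trans _ _ (n%:R * (7 * ((3 / 2 * D / n%:R) ^+ 2 * b ^+ 4)))).
    by rewrite !ler_wpM2l// ler_wpM2r// exprn_ge0// ltW.
  rewrite b4 (_ : _ * _ = 63 / 4 * eps ^+ 4); last by field; rewrite !gt_eqF.
  by lra.
- by rewrite divr_gt0.
(* The ratio is at most (3D/2) / (D/4)^2 = 24/D, which is at most 1/2 because [D >= 48]. *)
- rewrite npE ler_pdivrMr ?exprn_gt0 ?divr_gt0//.
  by rewrite expr2; nra.
- move=> f; rewrite npE ltr_norml => /andP[f1 f2].
  (* The count lies between k0 + D/4 and k0 + 3D/4, so [nonzeros f - k0] is not truncated. *)
  have kN : (k0 <= nonzeros f)%N by rewrite -(ler_nat R); lra.
  split.
    by rewrite /sparse_ball/= l0norm_signal// -(ler_nat R) natrD -/D; lra.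
  apply: (@le_d2_set_sparse_ball _ _ _ _ a); first exact: ltW.
    move=> i; rewrite mxE /atom.
    by case: (f i) => [[|[|[|//]]] h]; rewrite /= ?eqxx ?sqrrN.
  rewrite l0norm_signal// natrB// rho2 a2 /b -Dv.
  rewrite (_ : _ * (D * v) = (D / 4) * (sigma_p ^+ 2 * (eps * v))); last by field.
  apply: ler_wpM2r; last lra.
  by rewrite mulr_ge0 ?sqr_ge0// mulr_ge0// ltW.
Qed.
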